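(* If a filiform nilpotent metric Lie algebra $\mathfrak g$ of dimension $n$ possesses a totally geodesic subalgebra of codimension two, then $\mathfrak g$ is isomorphic (as a Lie algebra) to the standard filiform Lie algebra $L_n$.
   Context: All Lie algebras are finite-dimensional and over $\mathbb R$. A nilpotent Lie algebra $\mathfrak g$ of dimension $n$ is filiform if there exists $X\in\mathfrak g$ with $\operatorname{ad}^{n-2}(X)\neq 0$, where $\operatorname{ad}(X)(Y)=[X,Y]$ and $\operatorname{ad}^k(X)$ is the $k$-fold composition. The standard filiform algebra $L_n$ is the $n$-dimensional real Lie algebra with basis $\{X_1,\dots,X_n\}$ whose only nonzero relations (up to antisymmetry) are $[X_1,X_i]=X_{i+1}$ for $i=2,\dots,n-1$. A metric Lie algebra is a Lie algebra $\mathfrak g$ equipped with an inner product $\langle\cdot,\cdot\rangle$ (arbitrary; no compatibility with the bracket is assumed). Its Levi-Civita connection $\nabla$ is given by $2\langle\nabla_XY,Z\rangle=\langle[X,Y],Z\rangle+\langle[Z,X],Y\rangle+\langle[Z,Y],X\rangle$ for all $X,Y,Z\in\mathfrak g$. A subalgebra $\mathfrak h$ of $\mathfrak g$ is totally geodesic if $\nabla_YZ\in\mathfrak h$ for all $Y,Z\in\mathfrak h$. *)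

(* Defs.v *)
From HB Require Import structures.
From mathcomp Require Import all_boot all_order all_algebra.
From mathcomp Require Import ring boolp reals.

Set Implicit Arguments.
Unset Strict Implicit.
Unset Printing Implicit Defensive.

Import Order.TTheory GRing.Theory Num.Theory.
Local Open Scope ring_scope.

HB.mixin Record Vector_isLieAlgebra (R : fieldType) V of Vector R V := {
  lie : V -> V -> V;
  lie_bilinear : bilinear_for *:%R *:%R lie;
  liexx : forall x, lie x x = 0;
  lie_jacobi : forall x y z,
    lie x (lie y z) + lie y (lie z x) + lie z (lie x y) = 0
}.

#[short(type="lieAlgType")]
HB.structure Definition LieAlgebra (R : fieldType) :=
  { V of Vector R V & Vector_isLieAlgebra R V }.

HB.instance Definition _ (R : fieldType) (g : lieAlgType R) :=
  bilinear_isBilinear.Build R g g g *:%R *:%R (@lie R g) lie_bilinear.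

Section LieAlgebraNotions.
Variables (R : fieldType) (g : lieAlgType R).
Implicit Types (x y : g) (U V W h : {vspace g}).

Lemma lieC x y : lie x y = - lie y x.
Proof.
apply/eqP; rewrite -addr_eq0; apply/eqP.
by have := liexx (x + y); rewrite linearDl !linearDr /= !liexx add0r addr0.
Qed.

(* [U, V] is spanned by the brackets [u, v] for u in U and v in V; by
   bilinearity it is enough to take u and v in bases. *)
Definition lie_prodv U V : {vspace g} :=
  <<allpairs (@lie R g) (vbasis U) (vbasis V)>>%VS.

Lemma lie_prodvP U V W :
  reflect {in U & V, forall u v, lie u v \in W} (lie_prodv U V <= W)%VS.
Proof.
apply: (iffP idP) => [sUVW u v Uu Vv | sW]; last first.
  by apply/span_subvP=> _ /allpairsP[[u v] /= [Uu Vv ->]]; apply: sW;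
     exact: vbasis_mem.
apply: (subvP sUVW).
rewrite (coord_vbasis Uu) (coord_vbasis Vv) linear_sumlz rpred_sum // => i _.
rewrite linear_sumr rpred_sum // => j _.
rewrite linearZl_LR linearZr_LR !memvZ //; apply: memv_span.
by apply: allpairs_f; apply: memt_nth.
Qed.

Definition lower_central k : {vspace g} := iter k (lie_prodv fullv) fullv.

Definition lie_nilpotent := exists k, lower_central k = 0%VS.

(* ad^(n-2)(x) is a nonzero map; for n <= 2 it is the identity map. *)
Definition filiform :=
  lie_nilpotent /\ exists x y, iter (\dim {:g} - 2)%N (lie x) y != 0.

Definition lie_subalgebra h := {in h &, forall x y, lie x y \in h}.

End LieAlgebraNotions.

Definition lie_isomorphic (R : fieldType) (g g' : lieAlgType R) :=
  exists2 f : {linear g -> g'},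
    bijective f & forall x y, f (lie x y) = lie (f x) (f y).

Section MetricLieAlgebra.
Variables (R : realType) (g : lieAlgType R) (dot : {dot g for idfun}).

Definition levi_civita (nabla : g -> g -> g) := forall x y z,
  2 * dot (nabla x y) z = dot (lie x y) z + dot (lie z x) y + dot (lie z y) x.

Definition totally_geodesic (nabla : g -> g -> g) (h : {vspace g}) :=
  {in h &, forall y z, nabla y z \in h}.

Lemma dotC x y : dot x y = dot y x.
Proof. by rewrite hermitian_subproof expr0 mul1r. Qed.

Lemma dot_inj x y : dot x =1 dot y -> x = y.
Proof.
move=> exy; apply/eqP; rewrite -subr_eq0; apply/negPn/negP => /neq0_dnorm_gt0.
by move/(_ _ dot); rewrite linearBl /= exy subrr ltxx.
Qed.

Lemma dot_riesz (f : {linear g -> R^o}) : exists u, dot u =1 f.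
Proof.
pose b := vbasis {:g}.
pose T u : g := \sum_(i < \dim {:g}) dot u b`_i *: b`_i.
have Tlin : linear T.
  move=> a u v; rewrite /T scaler_sumr -big_split; apply: eq_bigr => i _ /=.
  by rewrite linearDl linearZl_LR /= scalerDl scalerA.
pose L : {linear g -> g} := HB.pack T (GRing.isLinear.Build _ _ _ _ T Tlin).
have freeb : free b := basis_free (vbasisP _).
have Tcoef (k : 'I_(\dim {:g}) -> R) u :
    T u = \sum_(i < \dim {:g}) k i *: b`_i -> forall v, dot u v = \sum_(i < \dim {:g}) coord b i v * k i.
  move=> Tu v; have dk (i : 'I_(\dim {:g})) : dot u b`_i = k i.
    by have /(congr1 (coord b i)) := Tu; rewrite !coord_sum_free.
  rewrite {1}(coord_vbasis (memvf v)) linear_sumr; apply: eq_bigr => i _.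
  by rewrite linearZr_LR /= dk.
have ker0 : (lker (linfun L) == 0)%VS.
  apply/lker0P => u v; rewrite !lfunE /= => eT; apply: dot_inj => w.
  by rewrite (Tcoef _ u eT) (Tcoef _ v erefl).
pose w : g := \sum_(i < \dim {:g}) f b`_i *: b`_i.
exists ((linfun L)^-1%VF w) => v.
rewrite (Tcoef (fun i => f b`_i)); last first.
  by rewrite -[RHS](lker0_lfunVK ker0) [in RHS]lfunE.
rewrite [in RHS](coord_vbasis (memvf v)) linear_sum; apply: eq_bigr => i _.
by rewrite linearZ.
Qed.

Lemma levi_civita_exists : exists nabla, levi_civita nabla.
Proof.
pose K x y z := dot (lie x y) z + dot (lie z x) y + dot (lie z y) x.
have Klin x y : linear (K x y : g -> R^o).
  move=> a u v; rewrite /K !(linearDl, linearDr, linearZl_LR, linearZr_LR) /=.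
  by rewrite /GRing.scale /=; ring.
have /choice[nabla Hn] : forall p : g * g,
    exists u, forall z, 2 * dot u z = K p.1 p.2 z.
  move=> [x y] /=.
  pose L : {linear g -> R^o} := HB.pack (K x y : g -> R^o)
    (GRing.isLinear.Build _ _ _ _ (K x y : g -> R^o) (Klin x y)).
  have [u uE] := dot_riesz L; exists (2^-1 *: u) => z.
  by rewrite linearZl_LR /= uE mulrA divff ?mul1r ?pnatr_eq0.
by exists (fun x y => nabla (x, y)) => x y z; rewrite Hn.
Qed.

Lemma levi_civita_unique nabla nabla' :
  levi_civita nabla -> levi_civita nabla' -> nabla =2 nabla'.
Proof.
move=> H H' x y; apply: dot_inj => z.
by apply: (mulfI (_ : 2 != 0)); rewrite ?pnatr_eq0 // H H'.
Qed.

End MetricLieAlgebra.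

(* The standard filiform algebra L_n, on row vectors. std_gen i is the basis
   vector X_i for 1 <= i <= n (indices start at 1, and X_i = 0 otherwise), and
   std_coord x i is the X_i-coordinate of x. *)
Definition std_filiform (R : fieldType) (n : nat) := 'rV[R]_n.

Section StandardFiliform.
Variables (R : fieldType) (n : nat).
Local Notation L := (std_filiform R n).

HB.instance Definition _ := Vector.copy L 'rV[R]_n.

Implicit Types (x y z : L).

Definition std_gen (i : nat) : L := \row_(j < n) (j.+1 == i)%:R.

Definition std_coord x (i : nat) : R := \sum_(j < n | j.+1 == i) x ord0 j.

Definition std_lie x y : L := \sum_(2 <= i < n)
  (std_coord x 1 * std_coord y i - std_coord y 1 * std_coord x i)
    *: std_gen i.+1.

Lemma std_coordD x y i : std_coord (x + y) i = std_coord x i + std_coord y i.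
Proof. by rewrite -big_split; apply: eq_bigr => j _; rewrite mxE. Qed.

Lemma std_coordZ a x i : std_coord (a *: x) i = a * std_coord x i.
Proof. by rewrite mulr_sumr; apply: eq_bigr => j _; rewrite mxE. Qed.

Lemma std_coord0 i : std_coord 0 i = 0.
Proof. by apply: big1 => j _; rewrite mxE. Qed.

Lemma std_coord_sum I (r : seq I) (F : I -> L) i :
  std_coord (\sum_(k <- r) F k) i = \sum_(k <- r) std_coord (F k) i.
Proof.
apply: (big_morph (std_coord ^~ i)) => [x y|].
  exact: std_coordD.
exact: std_coord0.
Qed.

Lemma std_coord_ord x (j : 'I_n) : std_coord x j.+1 = x ord0 j.
Proof.
rewrite /std_coord (big_pred1 j) // => k; by rewrite eqSS.
Qed.

Lemma std_coord_inj x y :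
  (forall i, (0 < i <= n)%N -> std_coord x i = std_coord y i) -> x = y.
Proof.
move=> exy; apply/rowP => j.
by have := exy j.+1 (ltn_ord j); rewrite !std_coord_ord.
Qed.

Lemma std_coord_gen i j :
  std_coord (std_gen j) i = ((0 < i <= n)%N && (i == j))%:R.
Proof.
rewrite /std_coord; case: i => [|i] /=; first by rewrite big_pred0.
case: ltnP => lt_in.
  rewrite (big_pred1 (Ordinal lt_in)) ?mxE // => k; exact: eqSS.
rewrite big_pred0 // => k; apply/negbTE; rewrite eqSS.
by rewrite neq_ltn (leq_trans (ltn_ord k)).
Qed.

Lemma std_coord_lie x y i : (0 < i <= n)%N ->
  std_coord (std_lie x y) i =
  if (2 < i)%N then
    std_coord x 1 * std_coord y i.-1 - std_coord y 1 * std_coord x i.-1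
  else 0.
Proof.
move=> /andP[i0 le_in].
rewrite std_coord_sum.
under eq_bigr do rewrite std_coordZ std_coord_gen i0 le_in /=.
case: ltnP => lti.
  case: i i0 le_in lti => // i _ le_in lti.
  have i_in : i \in index_iota 2 n by rewrite mem_index_iota -ltnS lti.
  rewrite (bigD1_seq i) ?iota_uniq //= big1 ?addr0.
    by rewrite eqxx mulr1.
  by move=> j /negbTE nji; rewrite eqSS eq_sym nji mulr0.
rewrite big_seq big1 // => j; rewrite mem_index_iota => /andP[j2 _].
by rewrite (ltn_eqF (leq_ltn_trans lti (_ : (2 < j.+1)%N))) ?mulr0.
Qed.

Fact std_lie_bilinear : bilinear_for *:%R *:%R std_lie.
Proof.
split=> [y|x] a u v; apply: std_coord_inj => i hi;
  rewrite std_coordD std_coordZ !std_coord_lie //;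
  case: ifP => _; rewrite ?std_coordD ?std_coordZ; by [ring | rewrite mulr0 addr0].
Qed.

Fact std_liexx x : std_lie x x = 0.
Proof. by apply: big1 => i _; rewrite subrr scale0r. Qed.

Fact std_lie_jacobi x y z :
  std_lie x (std_lie y z) + std_lie y (std_lie z x) + std_lie z (std_lie x y)
  = 0.
Proof.
apply: std_coord_inj => i /[dup] hin /andP[i0 hi].
rewrite std_coord0 !std_coordD !(std_coord_lie _ _ hin).
case: ifP => lt2i; last by rewrite !addr0.
have n0 : (0 < n)%N := leq_trans i0 hi.
have hi' : (0 < i.-1 <= n)%N.
  by case: i {i0 hin} hi lt2i => // i hi lt2i; rewrite /= (ltnW hi) andbT ltnW.
rewrite !(std_coord_lie _ _ hi') !(std_coord_lie _ _ (_ : 0 < 1 <= n)%N) //=.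
by case: ifP => _; ring.
Qed.

HB.instance Definition _ := Vector_isLieAlgebra.Build R L
  std_lie_bilinear std_liexx std_lie_jacobi.

Lemma std_gen_basis x : x = \sum_(1 <= i < n.+1) std_coord x i *: std_gen i.
Proof.
apply: std_coord_inj => i /[dup] /andP[i0 le_in] hi.
rewrite std_coord_sum.
rewrite (bigD1_seq i) ?iota_uniq ?mem_index_iota //= big1 ?addr0.
  by rewrite std_coordZ std_coord_gen hi eqxx mulr1.
move=> j /negbTE nji; rewrite std_coordZ std_coord_gen eq_sym nji.
by rewrite andbF mulr0.
Qed.

Lemma lie_std_gen1 i : (2 <= i < n)%N ->
  lie (std_gen 1) (std_gen i) = std_gen i.+1.
Proof.
move=> /andP[i2 ltin]; apply: std_coord_inj => k /andP[k0 le_kn].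
have n0 : (0 < n)%N := leq_trans k0 le_kn.
rewrite std_coord_lie ?k0 // !std_coord_gen /= n0 /=.
case: k k0 le_kn => // k _ le_kn; rewrite eqSS (ltnW le_kn) /=.
rewrite (ltn_eqF i2) mul0r subr0 mul1r andbT.
case: (ltnP 2 k.+1) => [lt2k|]; first by rewrite (ltnW (lt2k : (1 < k)%N)) le_kn.
by move=> lt_k2; rewrite [k == i]ltn_eqF ?andbF //; exact: leq_trans lt_k2 i2.
Qed.

Lemma lie_std_gen0 i j : (1 < i)%N -> (1 < j)%N ->
  lie (std_gen i) (std_gen j) = 0.
Proof.
move=> i1 j1; apply: big1 => k _; rewrite !std_coord_gen.
by rewrite (ltn_eqF i1) (ltn_eqF j1) !andbF !mul0r subrr scale0r.
Qed.

Lemma lie_std_genn : lie (std_gen 1) (std_gen n) = 0.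
Proof.
apply: big1_seq => k; rewrite mem_index_iota => /andP[_ /andP[k2 ltkn]].
rewrite !std_coord_gen (ltn_eqF ltkn) [k == 1]gtn_eqF //.
by rewrite !andbF !mulr0 subrr scale0r.
Qed.

End StandardFiliform.

(* Main.v *)
Require Import Defs.
From HB Require Import structures.
From mathcomp Require Import all_boot all_order all_algebra.
From mathcomp Require Import reals.

Set Implicit Arguments.
Unset Strict Implicit.
Unset Printing Implicit Defensive.

Import Order.TTheory GRing.Theory Num.Theory.
Local Open Scope ring_scope.

(** The totally geodesic condition says that, for x orthogonal to the
    subalgebra h, the component of ad x tangent to h is skew-symmetric on h.
    In a nilpotent Lie algebra ad x is nilpotent, and a skew-symmetric nilpotent
    endomorphism of a Euclidean space vanishes. This is used twice.

    Since normalizers grow in a nilpotent algebra, some x orthogonal to h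
    normalizes h, and likewise some y orthogonal to m = h + <x> normalizes m,
    which is therefore an ideal of codimension one. The first use, on h itself,
    gives [x, h] = 0, so x lies in the centre Z of m. The second use is modulo
    Z, which ad y preserves: the orthogonal complement of Z in m is orthogonal
    to x, hence contained in h, so ad y is skew there modulo Z
    ([nilpotent_skew]) and [y, m] is contained in Z
    ([totally_geodesic_hyperplane]).

    For a filiform g the derived algebra has codimension at most two, because
    the nonzero vectors among e, [x, e], [x, [x, e]], ... are free. Hence m is spanned by a single
    vector a together with [g, g], and [g, g] is contained in Z + [m, m]; so
    m = Z + <a> + [m, m]. Bracketing this decomposition with itself pushes
    [m, m] down the whole lower central series, so m is abelian
    ([codim1_abelian]).

    Once g has an abelian ideal m of codimension one, every bracket is determined
    by ad y on m, and filiformity makes ad y a single nilpotent Jordan block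
    there: y, e, [y, e], [y, [y, e]], ... is a basis with the multiplication
    table of the standard filiform algebra ([standard_filiform_isomorphism]). *)

(** * Subspaces of codimension one and nilpotent chains *)

Section LinearAlgebra.
Variables (F : fieldType) (V : vectType F).

Lemma ltn_dim_add_line (U : {vspace V}) a :
  a \notin U -> (\dim U < \dim (U + <[a]>))%N.
Proof.
move=> U'a; rewrite ltn_neqAle dimvS ?addvSl // andbT.
by rewrite (dimv_leqif_sup (addvSl U <[a]>%VS)) subv_add subvv -memvE.
Qed.

Lemma addv_line_codim1 (U W : {vspace V}) :
  (U <= W)%VS -> (\dim W <= (\dim U).+1)%N ->
  forall a, a \in W -> a \notin U -> W = (U + <[a]>)%VS.
Proof.
move=> sUW dW a Wa U'a; apply/esym/eqP.
rewrite eqEdim subv_add sUW -memvE Wa /=.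
exact: leq_trans dW (ltn_dim_add_line U'a).
Qed.

Lemma vspace_codim1 (U W : {vspace V}) :
  (U <= W)%VS -> (\dim W <= (\dim U).+1)%N ->
  exists2 a, a \in W & (W <= U + <[a]>)%VS.
Proof.
move=> sUW dW; have [sWU|/subvPn[a Wa U'a]] := boolP (W <= U)%VS.
  by exists 0; rewrite ?mem0v // (subv_trans sWU) ?addvSl.
by exists a => //; rewrite -(addv_line_codim1 sUW dW Wa U'a).
Qed.

(** If v were a combination of f v, f (f v), ..., then applying the last power of
    f that does not kill v would kill the right-hand side but not v. *)
Lemma free_traject (f : {linear V -> V}) p v :
  (exists k, iter k f v = 0) -> iter p f v != 0 -> free (traject f v p.+1).
Proof.
have iter_lin k : linear (iter k f).
  by elim: k => [//|k IHk] a u w; rewrite !iterS IHk linearP.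
elim: p v => [|p IHp] v nil_v nz_v.
  by rewrite /= free_cons nil_free andbT span_nil memv0.
rewrite trajectS free_cons IHp; last by rewrite -iterSr.
  rewrite andbT; apply/negP => v_in.
  have ex0 : exists k, iter k f v == 0 by have [k /eqP] := nil_v; exists k.
  have [[|k] /eqP fk0 kmin] := ex_minnP ex0.
    have v0 : v = 0 by [].
    by rewrite v0 iter_fix ?linear0 ?eqxx in nz_v.
  pose L : {linear V -> V} := HB.pack (iter k f : V -> V)
    (GRing.isLinear.Build _ _ _ _ (iter k f) (iter_lin k)).
  have sK : (<<traject f (f v) p.+1>> <= lker (linfun L))%VS.
    apply/span_subvP => _ /trajectP[i _ ->].
    rewrite memv_ker lfunE /= -iterSr -iterD addnC iterD iterSr -iterS fk0.
    by apply/eqP; apply: iter_fix; rewrite linear0.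
  suff /kmin : iter k f v == 0 by rewrite ltnn.
  by have := subvP sK _ v_in; rewrite memv_ker lfunE.
have [k fk] := nil_v; exists k.
by rewrite -iterSr iterS fk linear0.
Qed.

End LinearAlgebra.

(** * Nilpotent maps that are skew-symmetric modulo a subspace *)

Section Orthogonality.
Variables (R : realType) (V : vectType R) (dot : {dot V for idfun}).

Lemma dot_eq0 (x : V) : dot x x = 0 -> x = 0.
Proof.
move=> x0; apply/eqP/negPn/negP => /neq0_dnorm_gt0.
by move/(_ _ dot); rewrite x0 ltxx.
Qed.

Lemma dot_sym (x y : V) : dot x y = dot y x.
Proof. by rewrite hermitian_subproof expr0 mul1r. Qed.

(** Gram-Schmidt, by induction on a spanning sequence x :: s of W: correct the
    projection to <<s>> along e, the part of x orthogonal to <<s>>. The formula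
    for the coefficient c is harmless when e = 0, as division by 0 gives 0. *)
Lemma orthogonal_projection (W : {vspace V}) a :
  exists2 w, w \in W & forall u, u \in W -> dot (a - w) u = 0.
Proof.
suff seqP : forall (s : seq V) a, exists2 w, w \in <<s>>%VS &
    forall u, u \in <<s>>%VS -> dot (a - w) u = 0.
  by have := seqP (vbasis W) a; rewrite (span_basis (vbasisP W)).
elim=> [|x s IHs] {}a.
  exists 0; rewrite ?mem0v // => u; rewrite span_nil memv0 => /eqP->.
  by rewrite linear0r.
have [wa s_wa oa] := IHs a; have [wx s_wx ox] := IHs x.
pose e := x - wx; pose c := dot (a - wa) e / dot e e.
have ce : dot (a - wa) e - c * dot e e = 0.
  have [e0|nz_e] := eqVneq (dot e e) 0.
    by rewrite e0 (dot_eq0 e0) linear0r mulr0 subrr.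
  by rewrite /c mulfVK ?subrr.
have or u : u \in <<s>>%VS -> dot (a - (wa + c *: e)) u = 0.
  by move=> su; rewrite opprD addrA linearBl linearZl_LR /= oa // ox // mulr0 subrr.
exists (wa + c *: e).
  rewrite span_cons scalerBr addrCA memv_add ?memvZ ?memv_line //.
  by rewrite memvB ?memvZ.
have orx : dot (a - (wa + c *: e)) x = 0.
  rewrite -[X in dot _ X](subrK wx x) linearDr /= [dot _ wx]or // addr0.
  by rewrite opprD addrA linearBl linearZl_LR /= ce.
move=> u; rewrite span_cons => /memv_addP[_ /vlineP[k ->] [u' su' ->]].
by rewrite linearDr /= [dot _ u']or // addr0 linearZr_LR /= orx mulr0.
Qed.

(** When W = 0 this says that a nilpotent skew-symmetric endomorphism vanishes,
    because |f u|^2 = - <f (f u), u>, so that f (f u) = 0 forces f u = 0. For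
    general W the same computation on the complement of W in U shows that
    f (f u) in W forces f u in W; descending from a power of f that is zero
    gives the result. *)
Lemma nilpotent_skew (f : {linear V -> V}) (W U : {vspace V}) :
    (W <= U)%VS -> {in U, forall u, f u \in U} -> {in W, forall w, f w \in W} ->
    (exists k, forall u, u \in U -> iter k f u = 0) ->
    (forall u v, u \in U -> v \in U ->
       {in W, forall w, dot u w = 0} -> {in W, forall w, dot v w = 0} ->
       dot (f u) v + dot (f v) u = 0) ->
  {in U, forall u, f u \in W}.
Proof.
move=> sWU fU fW [k fk] skew.
have ffW u : u \in U -> f (f u) \in W -> f u \in W.
  move=> Uu ffu; have [w Ww ow] := orthogonal_projection W u.
  have Uw : w \in U := subvP sWU _ Ww.
  (* v is the component of f u0 orthogonal to W; skewness shows |v|^2 = 0. *)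
  set u0 := u - w in ow; have Uu0 : u0 \in U by rewrite memvB.
  have ffu0 : f (f u0) \in W.
    rewrite [f u0]linearB [f (_ - _)]linearB memvB //.
    exact/fW/fW.
  have [z Wz oz] := orthogonal_projection W (f u0).
  set v := f u0 - z in oz.
  have Uv : v \in U by rewrite memvB ?fU // (subvP sWU).
  have v0 : v = 0.
    apply: dot_eq0; have := skew u0 v Uu0 Uv ow oz.
    have -> : dot (f u0) v = dot v v.
      by rewrite -{1}(subrK z (f u0)) linearDl /= [dot z _]dot_sym oz // addr0.
    have -> : dot (f v) u0 = 0; last by rewrite addr0.
    rewrite dot_sym [f v]linearB [dot u0 _]linearBr /=.
    by rewrite (ow _ ffu0) (ow _ (fW _ Wz)) subrr.
  have fu0 : f u0 \in W by move/subr0_eq: v0 => ->.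
  by rewrite -(subrK w u) linearD memvD ?(fW _ Ww).
move=> u Uu; have : iter k.+1 f u \in W by rewrite iterS fk // linear0 mem0v.
elim: {fk}k => [//|k IHk] fkW; apply/IHk/ffW => //.
by elim: k {IHk fkW} => [//|k IHk]; apply: fU.
Qed.

End Orthogonality.

(** * Nilpotent and filiform Lie algebras *)

Section LieAlgebra.
Variables (F : fieldType) (g : lieAlgType F).
Implicit Types (x y u v : g) (U W h m : {vspace g}).

Lemma lie_prodv_mem U W u v : u \in U -> v \in W -> lie u v \in lie_prodv U W.
Proof. by move=> Uu Wv; apply: (lie_prodvP _ _ _ (subvv _)). Qed.

Lemma lie_lower_central k x y :
  y \in lower_central g k -> lie x y \in lower_central g k.+1.
Proof. by move=> yk; apply: lie_prodv_mem; rewrite ?memvf. Qed.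

Lemma iter_lie_lower_central k x y : iter k (lie x) y \in lower_central g k.
Proof. by elim: k => [|k IHk]; rewrite ?memvf //; apply: lie_lower_central. Qed.

Lemma ad_nilpotent x :
  lie_nilpotent g -> exists k, forall y, iter k (lie x) y = 0.
Proof.
move=> [k gk0]; exists k => y; apply/eqP; rewrite -memv0 -gk0.
exact: iter_lie_lower_central.
Qed.

(** Any x outside h in the last term of the lower central series not contained
    in h will do, since [x, g] lies in the next term. *)
Lemma nilpotent_normalizer_grows h :
  lie_nilpotent g -> h <> fullv ->
  exists2 x, x \notin h & {in h, forall u, lie x u \in h}.
Proof.
move=> [k gk0] hN1.
have ex_k : exists k, (lower_central g k <= h)%VS by exists k; rewrite gk0 sub0v.
have [[|j] sjh jmin] := ex_minnP ex_k.
  by case: hN1; apply/eqP; rewrite eqEsubv subvf.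
have /subvPn[x xj h'x] : ~~ (lower_central g j <= h)%VS.
  by apply/negP => /jmin; rewrite ltnn.
exists x => // u hu; rewrite lieC memvN.
exact/(subvP sjh)/lie_lower_central.
Qed.

(** Partial applications of a bilinear map are not recognized as linear maps, and
    kernels and [nilpotent_skew] require one. *)
HB.instance Definition _ x :=
  GRing.isLinear.Build F g g *:%R (lie x) (linearPr (@lie F g) x).

Lemma mem_lker_ad x z : (z \in lker (linfun (lie x))) = (lie x z == 0).
Proof.
by rewrite memv_ker; congr (_ == 0); exact: (lfunE (lie x : {linear g -> g})).
Qed.

(** By bilinearity it is enough to commute with a basis of m; the encoding by
    kernels makes the centre a subspace by construction. *)
Definition lie_centre m : {vspace g} :=
  (m :&: \bigcap_(i < \dim m) lker (linfun (lie (vbasis m)`_i)))%VS.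

Lemma lie_centreP m z :
  reflect (z \in m /\ {in m, forall u, lie u z = 0}) (z \in lie_centre m).
Proof.
apply: (iffP memv_capP) => -[mz cz]; split=> //.
  move=> u mu; rewrite (coord_vbasis mu) linear_sumlz big1 // => i _.
  move: cz; rewrite memvE => /subv_bigcapP/(_ i isT).
  by rewrite -memvE mem_lker_ad linearZl_LR /= => /eqP->; rewrite scaler0.
rewrite memvE; apply/subv_bigcapP => i _; rewrite -memvE mem_lker_ad cz //.
by apply: vbasis_mem; apply: mem_nth; rewrite size_tuple.
Qed.

Lemma lie_centre_sub m : (lie_centre m <= m)%VS.
Proof. exact: capvSl. Qed.

(** The Jacobi identity: [u, [y, z]] is a sum of brackets of z with elements
    of m. *)
Lemma lie_centre_stable m y : {in m, forall u, lie y u \in m} ->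
  {in lie_centre m, forall z, lie y z \in lie_centre m}.
Proof.
move=> my z /lie_centreP[mz cz]; apply/lie_centreP; split=> [|u mu]; first exact: my.
have := lie_jacobi u y z; rewrite [lie z u]lieC (cz u mu) oppr0 linear0r addr0.
have -> : lie z (lie u y) = 0; last by rewrite addr0.
by apply/eqP; rewrite lieC oppr_eq0 cz // lieC memvN my.
Qed.

(** If ad(x)^(n-2) y is nonzero, then the n - 2 brackets [x, y], [x, [x, y]], ...
    are free. *)
Lemma filiform_dim_derived :
  filiform g -> (\dim {:g} - 2 <= \dim (lower_central g 1))%N.
Proof.
move=> [nil_g [x [y]]]; case: (_ - 2)%N => [|p] // nz.
have free_s : free (traject (lie x) (lie x y) p.+1).
  apply: free_traject; last by rewrite -iterSr.
  by have [k adk] := ad_nilpotent x nil_g; exists k.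
have <- : \dim <<traject (lie x) (lie x y) p.+1>> = p.+1.
  by rewrite -[RHS](size_traject (lie x) (lie x y)); apply/eqP.
apply/dimvS/span_subvP => _ /trajectP[i _ ->].
by rewrite -iterSr; apply: lie_lower_central; rewrite memvf.
Qed.

Section CodimensionOne.
Variables (m : {vspace g}) (y : g).
Hypotheses (dim_m : (\dim m).+1 = \dim {:g}) (m'y : y \notin m).

Lemma codim1_split x : exists2 u, u \in m & exists a, x = u + a *: y.
Proof.
have: x \in (m + <[y]>)%VS.
  by rewrite -(@addv_line_codim1 _ _ m {:g}) ?subvf ?memvf ?dim_m.
by move=> /memv_addP[u mu [_ /vlineP[a ->] ->]]; exists u => //; exists a.
Qed.

(** As g = m + <y> and [y, m] lies in the centre Z of m, [g, g] lies in
    Z + M with M = [m, m]; counting dimensions, m = Z + M + <a> for some a. In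
    the bracket of two elements of m the Z-parts drop out, and so does [a, a]:
    every remaining term has an entry in M. Thus M is contained in [g, M], hence
    in every term of the lower central series. *)
Lemma codim1_abelian :
  filiform g -> lie_subalgebra m ->
  {in m, forall u, lie y u \in lie_centre m} ->
  {in m &, forall u v, lie u v = 0}.
Proof.
move=> fil_g alg_m yZ; set Z := lie_centre m; pose M := lie_prodv m m.
have sMm : (M <= m)%VS by apply/lie_prodvP.
have sZm : (Z <= m)%VS := lie_centre_sub m.
have ZM_lie u v : u \in m -> v \in m -> lie u v \in (Z + M)%VS.
  by move=> mu mv; apply: (subvP (addvSr _ _)); apply: lie_prodv_mem.
have ZM_y u : u \in m -> lie y u \in (Z + M)%VS.
  by move=> mu; apply: (subvP (addvSl _ _)); apply: yZ.
have sDZM : (lower_central g 1 <= Z + M)%VS.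
  apply/lie_prodvP => x x' _ _.
  have [u mu [a ->]] := codim1_split x; have [v mv [b ->]] := codim1_split x'.
  rewrite linearDl !linearDr /= !(linearZl_LR, linearZr_LR) /= liexx !scaler0 addr0.
  rewrite [lie u y]lieC; apply: memvD; last by rewrite memvZ ?ZM_y.
  by rewrite memvD ?ZM_lie // memvZ // memvN ZM_y.
have [a ma sma] : exists2 a, a \in m & (m <= Z + M + <[a]>)%VS.
  apply: vspace_codim1; first by rewrite subv_add sZm.
  apply: leq_trans (_ : (\dim (lower_central g 1)).+1 <= _)%N; last first.
    by rewrite ltnS dimvS.
  have := filiform_dim_derived fil_g.
  by rewrite -dim_m; case: (\dim m) => [|d]; rewrite ?subSS ?subn0.
have sMk k : (M <= lower_central g k)%VS.
  elim: k => [|k IHk]; first exact: subvf.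
  apply/lie_prodvP => u v /(subvP sma).
  move=> /memv_addP[_ /memv_addP[z Zz [p Mp ->]] [_ /vlineP[c ->] ->]].
  move=> /(subvP sma).
  move=> /memv_addP[_ /memv_addP[z' Zz' [p' Mp' ->]] [_ /vlineP[c' ->] ->]].
  have Zl w t : w \in Z -> t \in m -> lie t w = 0 by case/lie_centreP => _ cw /cw.
  have Zr w t : w \in Z -> t \in m -> lie w t = 0 by move=> Zw mt; rewrite lieC Zl ?oppr0.
  have mp := subvP sMm _ Mp; have mp' := subvP sMm _ Mp'.
  have mz := subvP sZm _ Zz; have mz' := subvP sZm _ Zz'.
  rewrite -!addrA.
  have mq : p + c *: a \in m by rewrite memvD ?memvZ.
  have mq' : p' + c' *: a \in m by rewrite memvD ?memvZ.
  rewrite [lie (z + _) _]linearDl /= (Zr z) //; last exact: memvD.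
  rewrite add0r [lie _ (z' + _)]linearDr /= (Zl z') // add0r.
  rewrite [lie _ (p' + _)]linearDr /=; apply: memvD.
    by apply: (@lie_lower_central k); apply: (subvP IHk).
  rewrite linearZr_LR /= memvZ // [lie (p + _) a]linearDl /= linearZl_LR /= liexx.
  by rewrite scaler0 addr0 lieC memvN (@lie_lower_central k) // (subvP IHk).
have [[k gk0] _] := fil_g.
move=> u v mu mv; apply/eqP; rewrite -memv0 -gk0.
by apply: (subvP (sMk k)); apply: lie_prodv_mem.
Qed.

End CodimensionOne.
End LieAlgebra.

(** * Totally geodesic subalgebras of nilpotent metric Lie algebras *)

Section Metric.
Variables (R : realType) (g : lieAlgType R) (dot : {dot g for idfun}).
Implicit Types (x y u v : g) (h m : {vspace g}).

Lemma orthogonal_normalizer h :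
    lie_nilpotent g -> lie_subalgebra h -> h <> fullv ->
  exists x, [/\ x \notin h, {in h, forall u, dot x u = 0}
              & {in h, forall u, lie x u \in h}].
Proof.
move=> nil_g alg_h hN1.
have [x h'x hx] := nilpotent_normalizer_grows nil_g hN1.
have [w hw ow] := orthogonal_projection dot h x.
exists (x - w); split=> // [|u hu].
  by apply: contra h'x => hxw; rewrite -(subrK w x) memvD.
by rewrite linearBl /= memvB ?hx ?alg_h.
Qed.

Section TotallyGeodesic.
Variables (nabla : g -> g -> g) (h : {vspace g}).
Hypotheses (nil_g : lie_nilpotent g) (nablaP : levi_civita dot nabla).
Hypotheses (alg_h : lie_subalgebra h) (tg_h : totally_geodesic nabla h).

(** The Levi-Civita formula for <nabla_u v, x>, which vanishes along with
    <[u, v], x> because both vectors lie in h. *)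
Lemma totally_geodesic_skew x : {in h, forall u, dot x u = 0} ->
  {in h &, forall u v, dot (lie x u) v + dot (lie x v) u = 0}.
Proof.
move=> ox u v hu hv; have := nablaP u v x.
rewrite ![dot _ x]dot_sym !ox ?alg_h ?tg_h // mulr0 add0r.
by rewrite ![dot (lie x _) _]dot_sym => <-.
Qed.

Lemma orthogonal_normalizer_centralizes x : {in h, forall u, dot x u = 0} ->
  {in h, forall u, lie x u \in h} -> {in h, forall u, lie x u = 0}.
Proof.
move=> ox hx u hu; apply/eqP; rewrite -memv0.
apply: (@nilpotent_skew _ _ dot (lie x) 0%VS h) => //.
- exact: sub0v.
- by move=> w; rewrite memv0 => /eqP->; rewrite linear0 mem0v.
- by have [k adk] := ad_nilpotent x nil_g; exists k.
- by move=> v w hv hw _ _; apply: totally_geodesic_skew.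
Qed.

(** The hyperplane is m = h + <x> with x orthogonal to h normalizing h, and y is
    orthogonal to m. Vectors of m orthogonal to the centre of m are in
    particular orthogonal to x, hence lie in h, where ad y is skew-symmetric:
    this is what makes the nilpotent skew argument apply modulo the centre. *)
Lemma totally_geodesic_hyperplane : (\dim h + 2)%N = \dim {:g} ->
  exists m y, [/\ (\dim m).+1 = \dim {:g}, lie_subalgebra m, y \notin m
                & {in m, forall u, lie y u \in lie_centre m}].
Proof.
move=> dim_h.
have hN1 : h <> fullv.
  by move=> h1; move: dim_h; rewrite h1 addn2 => /eqP; rewrite gtn_eqF.
have [x [h'x ox hx]] := orthogonal_normalizer nil_g alg_h hN1.
have x0 := orthogonal_normalizer_centralizes ox hx.
pose m := (h + <[x]>)%VS.
have dim_m : (\dim m).+1 = \dim {:g}.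
  apply/eqP; rewrite -dim_h addn2 eqSS eqn_leq ltn_dim_add_line // andbT.
  rewrite -addn1; apply: leq_trans (dimv_add_leqif _ _) _.
  by rewrite dim_vline leq_add2l leq_b1.
have mx u : u \in m -> lie x u = 0.
  case/memv_addP=> v hv [_ /vlineP[c ->] ->].
  by rewrite linearDr linearZr_LR /= x0 // liexx scaler0 addr0.
have alg_m : lie_subalgebra m.
  move=> u v /memv_addP[u' hu [_ /vlineP[c ->] ->]] mv.
  rewrite linearDl linearZl_LR /= mx // scaler0 addr0.
  have /memv_addP[v' hv [_ /vlineP[d ->] ->]] := mv.
  rewrite linearDr linearZr_LR /= [lie u' x]lieC x0 // oppr0 scaler0 addr0.
  by rewrite (subvP (addvSl _ _)) ?alg_h.
have mN1 : m <> fullv.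
  by move=> m1; move: dim_m; rewrite m1 => /eqP; rewrite gtn_eqF.
have [y [m'y oy my]] := orthogonal_normalizer nil_g alg_m mN1.
exists m, y; split=> //.
have sZm := lie_centre_sub m.
have Zx : x \in lie_centre m.
  apply/lie_centreP; split=> [|u mu]; last by rewrite lieC mx ?oppr0.
  by rewrite (subvP (addvSr _ _)) ?memv_line.
apply: (@nilpotent_skew _ _ dot (lie y)) => //.
- exact: lie_centre_stable.
- by have [k adk] := ad_nilpotent y nil_g; exists k.
have hZ u : u \in m -> {in lie_centre m, forall w, dot u w = 0} -> u \in h.
  case/memv_addP=> v hv [_ /vlineP[c ->] ->] /(_ x Zx).
  rewrite linearDl linearZl_LR /= dot_sym ox // add0r => /eqP.
  rewrite mulf_eq0 => /orP[/eqP->|/eqP/dot_eq0 xx0]; first by rewrite scale0r addr0.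
  by rewrite xx0 mem0v in h'x.
move=> u v mu mv ou ov; apply: totally_geodesic_skew; rewrite ?hZ // => w hw.
by apply: oy; apply: (subvP (addvSl _ _)).
Qed.

End TotallyGeodesic.
End Metric.

(** * Filiform algebras with an abelian ideal of codimension one *)

Section StandardForm.
Variables (F : fieldType) (g : lieAlgType F) (p : nat).
Variables (m : {vspace g}) (y : g).
Hypotheses (dim_g : \dim {:g} = p.+2) (dim_m : (\dim m).+1 = \dim {:g}).
Hypotheses (m'y : y \notin m) (my : {in m, forall u, lie y u \in m}).
Hypothesis (cm : {in m &, forall u v, lie u v = 0}).

Let dimm : \dim m = p.+1.
Proof. by move: dim_m; rewrite dim_g => -[]. Qed.

Lemma iter_hyperplane k u : u \in m -> iter k (lie y) u \in m.
Proof. by move=> mu; elim: k => [//|k IHk]; apply: my. Qed.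

(** Let ad(x)^p z be nonzero, x = v + a y and z = w + b y with v, w in the abelian
    hyperplane m. Then [x, z] = [y, a w - b v], and ad x acts on m as a times
    ad y, so ad(x)^p z is a multiple of ad(y)^p (a w - b v) as soon as p > 0. *)
Lemma filiform_hyperplane_generator :
  filiform g -> exists2 e, e \in m & iter p (lie y) e != 0.
Proof.
move=> [_ [x [z]]]; rewrite dim_g subn2 /=.
case: p dimm => [|q] dq nz.
  (* In dimension two any nonzero vector of the line m generates it. *)
  exists (vpick m); rewrite ?memv_pick // vpick0 -dimv_eq0 dq //.
have [v mv [a Dx]] := codim1_split dim_m m'y x.
have [w mw [b Dz]] := codim1_split dim_m m'y z.
pose e := a *: w - b *: v.
have me : e \in m by rewrite memvB ?memvZ.
exists e => //.
suff itx k : iter k.+1 (lie x) z = a ^+ k *: iter k.+1 (lie y) e.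
  by apply: contra nz => /eqP ye0; rewrite itx ye0 scaler0.
elim: k => [|k IHk].
  rewrite expr0 scale1r /= Dx Dz.
  rewrite [lie (v + _) _]linearDl /= ![lie _ (w + _)]linearDr /= cm // add0r.
  rewrite linearZr_LR !linearZl_LR linearZr_LR /= liexx !scaler0 addr0.
  by rewrite /e linearBr !linearZr_LR /= [lie v y]lieC scalerN addrC.
rewrite iterS IHk iterS linearZr_LR /= -iterS; set t := iter _ _ _.
have mt : t \in m by apply: iter_hyperplane.
by rewrite Dx linearDl linearZl_LR /= cm // add0r scalerA exprSr.
Qed.

Variable e : g.
Hypotheses (nil_g : lie_nilpotent g) (me : e \in m) (nz_e : iter p (lie y) e != 0).

Let free_chain k : iter k (lie y) e != 0 -> free (traject (lie y) e k.+1).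
Proof.
by apply: free_traject; have [k' adk] := ad_nilpotent y nil_g; exists k'.
Qed.

Let chain_sub k : (<<traject (lie y) e k>> <= m)%VS.
Proof. by apply/span_subvP => _ /trajectP[i _ ->]; apply: iter_hyperplane. Qed.

(** Otherwise the chain would consist of p + 2 free vectors of m, whose dimension
    is p + 1. *)
Lemma filiform_chain_end : iter p.+1 (lie y) e = 0.
Proof.
apply/eqP/negPn/negP => /free_chain; rewrite /free size_traject => /eqP dk.
by have := dimvS (chain_sub p.+2); rewrite dk dimm ltnn.
Qed.

Lemma adapted_size : size (y :: traject (lie y) e p.+1) == p.+2.
Proof. by rewrite /= size_traject. Qed.

Definition adapted_basis : p.+2.-tuple g := Tuple adapted_size.

Lemma adapted_basisP : basis_of {:g} adapted_basis.
Proof.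
rewrite basisEfree subvf size_tuple dim_g leqnn andbT.
rewrite free_cons free_chain // !andbT.
by have /subvP sc := chain_sub p.+1; apply: contra m'y => /sc.
Qed.

(** The component in m of psi s below. *)
Let tail (s : std_filiform F p.+2) : g :=
  \sum_(0 <= i < p.+1) std_coord s i.+2 *: iter i (lie y) e.

Let m_tail s : tail s \in m.
Proof. by rewrite /tail rpred_sum // => i _; rewrite memvZ ?iter_hyperplane. Qed.

Let lie_tail s :
  lie y (tail s) = \sum_(0 <= i < p) std_coord s i.+2 *: iter i.+1 (lie y) e.
Proof.
rewrite linear_sumr big_nat_recr //= linearZr_LR /= -iterS.
rewrite filiform_chain_end scaler0 addr0.
by apply: eq_bigr => i _; rewrite linearZr_LR.
Qed.

(** The linear map sending X_1 to y and X_(i+2) to ad(y)^i e. *)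
Let psi (s : std_filiform F p.+2) : g :=
  \sum_(i < p.+2) s 0 i *: adapted_basis`_i.

Let psiE s : psi s = std_coord s 1 *: y + tail s.
Proof.
rewrite /psi big_ord_recl -(std_coord_ord s ord0) /=; congr (_ + _).
rewrite /tail big_mkord; apply: eq_bigr => i _.
rewrite -(std_coord_ord s) lift0 /=; congr (_ *: _).
rewrite -[RHS](nth_traject (lie y) (ltn_ord i)); apply: set_nth_default.
by rewrite -trajectS size_traject add0n ltn_ord.
Qed.

Let psi_lie s t : psi (lie s t) = lie (psi s) (psi t).
Proof.
rewrite !psiE.
rewrite [lie (_ + _) _]linearDl /= ![lie _ (_ + tail t)]linearDr /=.
rewrite (cm (m_tail s) (m_tail t)) addr0.
rewrite !(linearZl_LR, linearZr_LR) /= liexx !scaler0 add0r.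
rewrite [lie (tail s) y]lieC !lie_tail.
(* The bracket of L_n has zero coordinates along X_1 and X_2. *)
rewrite std_coord_lie // scale0r add0r /tail.
rewrite big_nat_recl // std_coord_lie // scale0r add0r.
rewrite scalerN !scaler_sumr -sumrB big_nat [RHS]big_nat.
apply: eq_bigr => i /andP[_ ltip].
by rewrite std_coord_lie //= !scalerA -scalerBl.
Qed.

Lemma standard_filiform_isomorphism : lie_isomorphic g (std_filiform F p.+2).
Proof.
have bB := adapted_basisP; set b := adapted_basis in bB.
pose phi v : std_filiform F p.+2 := \row_i coord b i v.
have phi_lin : linear phi by move=> a u v; apply/rowP => i; rewrite !mxE linearP.
pose L : {linear g -> std_filiform F p.+2} :=
  HB.pack phi (GRing.isLinear.Build _ _ _ _ phi phi_lin).
have phiK : cancel phi psi.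
  move=> v; rewrite [RHS](coord_basis bB (memvf v)).
  by apply: eq_bigr => i _; rewrite mxE.
have psiK : cancel psi phi.
  by move=> s; apply/rowP => i; rewrite mxE coord_sum_free ?(basis_free bB).
exists L => [|u v]; first by exists psi.
by rewrite /= -{1}(phiK u) -{1}(phiK v) -psi_lie psiK.
Qed.

End StandardForm.

(** * Filiform metric Lie algebras with a totally geodesic subalgebra of codimension two *)

Theorem theorem1p18 (R : realType) (g : lieAlgType R)
    (dot : {dot g for idfun}) (nabla : g -> g -> g)
    (h : {vspace g}) (n : nat) :
  \dim {:g} = n ->
  filiform g ->
  levi_civita dot nabla ->
  lie_subalgebra h ->
  totally_geodesic nabla h ->
  (\dim h + 2)%N = n ->
  lie_isomorphic g (std_filiform R n).
Proof.
move=> dim_g fil_g nablaP alg_h tg_h dim_h; have nil_g := fil_g.1.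
rewrite -dim_h addn2 in dim_g *.
have dim_h2 : (\dim h + 2)%N = \dim {:g} by rewrite dim_g addn2.
have [m [y [dim_m alg_m m'y yZ]]] :=
  totally_geodesic_hyperplane nil_g nablaP alg_h tg_h dim_h2.
have cm := codim1_abelian dim_m m'y fil_g alg_m yZ.
have my : {in m, forall u, lie y u \in m}.
  by move=> u /yZ/(subvP (lie_centre_sub m)).
have [e me nz_e] := filiform_hyperplane_generator dim_g dim_m m'y my cm fil_g.
exact: (standard_filiform_isomorphism dim_g dim_m m'y my cm nil_g me nz_e).
Qed.
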